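(* Let $\pi : (M, g_0) \rightarrow (N, g_N)$ be a Riemannian submersion. For every pair of sets: $\{ V_{n+1} , \ldots , V_{n+p} \}$ of vertical vector fields bounded on $(M,g_0)$, and $\{ W_{n+1} , \ldots , W_{n+p} \}$ of linearly independent vector fields bounded on $(N,g_N)$, there exists (for some $\epsilon>0$) a unique variation $\{ g_t, t \in (-\epsilon, \epsilon) \} \subset \mathrm{Riem}(M, \mathcal{V}, g_0)$ that preserves the Riemannian submersion $\pi$ and is such that for every $X \in \mathfrak{X}_{\mathcal{V}}$ $$B_t^\sharp X = \sum_{i=n+1}^{n+p} g_0(V_i , X)\, P_{\mathcal{H}}^t\, \pi^* W_i ,$$ where $\pi^* W_i$ is the unique $g_0$-horizontal lift of $W_i$, for all $i \in \{n+1, \ldots , n+p\}$.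
   Context: Manifolds are smooth, connected and oriented; all functions and tensor fields are smooth. $\mathfrak{X}_M$ is the set of vector fields on $M$. A Riemannian submersion $\pi:(M,g)\to(N,g_N)$ is a smooth map with $\operatorname{rank}\pi_*=\dim N$ and $g(X,Y)=g_N(\pi_*X,\pi_*Y)$ for all $X,Y$ that are $g$-orthogonal to $\ker\pi_*$. $\mathcal{V}=\ker\pi_*$ is the vertical distribution, $\mathfrak{X}_{\mathcal{V}}$ is the set of vector fields with values in $\mathcal{V}$ (vertical fields), $n=\dim\mathcal{V}$, $n+p=\dim M$ (so $p=\dim N$). $\mathrm{Riem}(M,\mathcal{V},g_0)$ is the set of Riemannian metrics $g$ on $M$ with $g(X,Y)=g_0(X,Y)$ for all $X,Y\in\mathfrak{X}_{\mathcal{V}}$. A variation of $g_0$ is a one-parameter family $\{g_t, t\in(-\epsilon,\epsilon)\}\subset \mathrm{Riem}(M,\mathcal{V},g_0)$ depending smoothly on $t$, whose member at $t=0$ is $g_0$. It preserves the Riemannian submersion $\pi$ if $\pi:(M,g_t)\to(N,g_N)$ is a Riemannian submersion for all $t\in(-\epsilon,\epsilon)$. $\mathcal{H}(t)$ is the $g_t$-orthogonal complement of $\mathcal{V}$ and $P_{\mathcal{H}}^t$ is the $g_t$-orthogonal projection onto $\mathcal{H}(t)$. $B_t=\partial_t g_t$ and $B_t^\sharp$ is defined by $g_t(B_t^\sharp X,Y)=B_t(X,Y)$ for all $X,Y\in\mathfrak{X}_M$. The $g_0$-horizontal lift $\pi^*W$ of $W\in\mathfrak{X}_N$ is the unique vector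 field with values in $\mathcal{H}(0)$ with $\pi_*(\pi^*W)=W$. A vector field $X$ is bounded on $(M,g)$ if $g(X,X)$ is a bounded function on $M$. Linear independence of vector fields means linear independence at every point. *)

(* Defs.v *)
From HB Require Import structures.
From mathcomp Require Import all_boot all_order all_algebra.
From mathcomp Require Import all_classical all_reals all_analysis.

Set Implicit Arguments.
Unset Strict Implicit.
Unset Printing Implicit Defensive.

Import Order.TTheory GRing.Theory Num.Theory.
Import numFieldNormedType.Exports.

Local Open Scope classical_set_scope.
Local Open Scope ring_scope.

(* Infinitely differentiable on U: every iterated partial derivative of [f] is
   differentiable (hence continuous) at every point of U. *)
Definition smooth_on (R : realType) (m : nat) (E : normedModType R)
    (U : set 'rV[R]_m) (f : 'rV[R]_m -> E) : Prop :=
  forall (s : seq 'I_m) (z : 'rV[R]_m), U z ->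
    differentiable
      (foldr (fun (i : 'I_m) (h : 'rV[R]_m -> E) => 'D_(delta_mx 0 i) h) f s) z.

(* Smooth, connected, oriented m-manifolds, given by an oriented atlas: the
   charts are indexed by [chart], and [uncoord c] is relevant only on the image
   of the domain of [c].  [chart_at] picks a chart around each point (no
   compatibility is required between the choices at different points); it
   serves only to represent tangent vectors, see below. *)
Structure manifold (R : realType) (m : nat) := Manifold {
  space :> topologicalType;
  chart : Type;
  dom : chart -> set space;
  coord : chart -> space -> 'rV[R]_m;
  uncoord : chart -> 'rV[R]_m -> space;
  chart_at : space -> chart;
  space_hausdorff : hausdorff_space space;
  space_second_countable : @second_countable space;
  space_connected : connected [set: space];
  dom_chart_at : forall x, dom (chart_at x) x;
  dom_open : forall c, open (dom c);
  coord_open : forall c, open (coord c @` dom c);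
  coordK : forall c x, dom c x -> uncoord c (coord c x) = x;
  coord_continuous : forall c x, dom c x -> {for x, continuous (coord c)};
  uncoord_continuous : forall c x, dom c x ->
    {for coord c x, continuous (uncoord c)};
  transition_smooth : forall c d,
    smooth_on (coord c @` (dom c `&` dom d)) (coord d \o uncoord c);
  transition_oriented : forall c d x, dom c x -> dom d x ->
    0 < \det ('J (coord d \o uncoord c) (coord c x))
}.

Section Geometry.
Variable R : realType.

(* The tangent space at x is represented by 'rV[R]_m: a tangent vector is the
   row of its components in the chart [chart_at x].  Right multiplication by
   [transition c d x] turns components in the chart c into components in d. *)
Definition transition m (M : manifold R m) (c d : chart M) (x : M) : 'M[R]_m :=
  'J (coord d \o uncoord c) (coord c x).

Definition vector_field m (M : manifold R m) (X : M -> 'rV[R]_m) : Prop :=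
  forall c : chart M, smooth_on (coord c @` dom c)
    (fun z => let x := uncoord c z in X x *m transition (chart_at x) c x).

(* A field of bilinear forms is given by its Gram matrices in the charts
   [chart_at x]; this is its Gram matrix in the chart c. *)
Definition gram m (M : manifold R m) (g : M -> 'M[R]_m) (c : chart M) (x : M) :
    'M[R]_m :=
  transition c (chart_at x) x *m g x *m (transition c (chart_at x) x)^T.

Definition inner m (M : manifold R m) (g : M -> 'M[R]_m) (x : M)
    (u v : 'rV[R]_m) : R :=
  (u *m g x *m v^T) 0 0.

Definition metric m (M : manifold R m) (g : M -> 'M[R]_m) : Prop :=
  [/\ forall x u v, inner g x u v = inner g x v u,
      forall x u, u != 0 -> 0 < inner g x u u
    & forall c : chart M, smooth_on (coord c @` dom c)
        (fun z => gram g c (uncoord c z))].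

Definition bounded_field m (M : manifold R m) (g : M -> 'M[R]_m)
    (X : M -> 'rV[R]_m) : Prop :=
  exists C : R, forall x, inner g x (X x) (X x) <= C.

Definition pointwise_independent m p (M : manifold R m)
    (W : 'I_p -> M -> 'rV[R]_m) : Prop :=
  forall x, row_free (\matrix_(i < p) W i x).

Definition smooth_map m p (M : manifold R m) (N : manifold R p) (pi : M -> N) :
    Prop :=
  continuous pi /\
  forall (c : chart M) (d : chart N),
    smooth_on (coord c @` (dom c `&` pi @^-1` dom d))
      (coord d \o pi \o uncoord c).

(* The differential at x, acting on rows: pi_* u = u *m differential pi x. *)
Definition differential m p (M : manifold R m) (N : manifold R p) (pi : M -> N)
    (x : M) : 'M[R]_(m, p) :=
  'J (coord (chart_at (pi x)) \o pi \o uncoord (chart_at x))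
     (coord (chart_at x) x).

Section Submersion.
Variables (m p : nat) (M : manifold R m) (N : manifold R p) (pi : M -> N).
Implicit Types (g : M -> 'M[R]_m) (gN : N -> 'M[R]_p) (x : M) (u v : 'rV[R]_m).

Definition vertical x : set 'rV[R]_m := [set v | v *m differential pi x = 0].

Definition horizontal g x : set 'rV[R]_m :=
  [set u | forall v, vertical x v -> inner g x u v = 0].

Definition vertical_field (X : M -> 'rV[R]_m) : Prop :=
  vector_field X /\ forall x, vertical x (X x).

Definition riemannian_submersion g gN : Prop :=
  [/\ smooth_map pi,
      forall x, \rank (differential pi x) = p
    & forall x u v, horizontal g x u -> horizontal g x v ->
        inner g x u v =
        inner gN (pi x) (u *m differential pi x) (v *m differential pi x)].

Definition Riem (g0 : M -> 'M[R]_m) : set (M -> 'M[R]_m) :=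
  [set g | metric g /\
    forall X Y, vertical_field X -> vertical_field Y ->
      forall x, inner g x (X x) (Y x) = inner g0 x (X x) (Y x)].

(* Only the values of [g] on ]-eps, eps[ are relevant.  Smooth dependence on t
   is joint smoothness in (t, x), expressed in each chart of M, the time t being
   the first entry of z. *)
Definition metric_variation (g0 : M -> 'M[R]_m) (eps : R) (g : R -> M -> 'M[R]_m) :
    Prop :=
  [/\ forall t, `|t| < eps -> Riem g0 (g t),
      g 0 = g0
    & forall c : chart M,
        smooth_on
          [set z : 'rV[R]_(1 + m) | `|lsubmx z 0 0| < eps /\
                                    (coord c @` dom c) (rsubmx z)]
          (fun z => gram (g (lsubmx z 0 0)) c (uncoord c (rsubmx z)))].

Definition preserves_submersion gN (eps : R) (g : R -> M -> 'M[R]_m) : Prop :=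
  forall t, `|t| < eps -> riemannian_submersion (g t) gN.

(* B_t, the time derivative of g_t *)
Definition dt (g : R -> M -> 'M[R]_m) (t : R) (x : M) : 'M[R]_m :=
  derive1 (fun s => g s x) t.

(* [sharp], [hproj] and [hlift] are definite descriptions; [sharpP], [hprojP]
   and [hliftP] show that the default value of [xget] is not used. *)
Definition sharp g (B : M -> 'M[R]_m) (X : M -> 'rV[R]_m) (x : M) : 'rV[R]_m :=
  xget 0 [set Z | forall v, inner g x Z v = inner B x (X x) v].

Definition hproj g x u : 'rV[R]_m :=
  xget 0 [set h | horizontal g x h /\ vertical x (u - h)].

Definition hlift g (W : N -> 'rV[R]_p) (x : M) : 'rV[R]_m :=
  xget 0 [set h | horizontal g x h /\ h *m differential pi x = W (pi x)].

Lemma innerBl g x u v w : inner g x (u - v) w = inner g x u w - inner g x v w.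
Proof. by rewrite /inner !mulmxBl !mxE. Qed.

Lemma inner_inj g x u v : metric g ->
  (forall w, inner g x u w = inner g x v w) -> u = v.
Proof.
move=> [_ gpos _] uv; apply/eqP; rewrite -subr_eq0; apply/negPn/negP => uv0.
by have := gpos x _ uv0; rewrite innerBl uv subrr ltxx.
Qed.

Lemma horizontal_vertical0 g x u : metric g ->
  horizontal g x u -> vertical x u -> u = 0.
Proof.
move=> [_ gpos _] hu vu; apply/eqP/negPn/negP => u0.
by have := gpos x _ u0; rewrite (hu _ vu) ltxx.
Qed.

Lemma gram_unit g x k (K : 'M[R]_(k, m)) : metric g -> row_free K ->
  K *m g x *m K^T \in unitmx.
Proof.
move=> [_ gpos _] Kfree; rewrite -row_free_unit -kermx_eq0.
apply/eqP/row_matrixP => i; rewrite row0; set w := row i _.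
have wK0 : w *m (K *m g x *m K^T) = 0 by apply/sub_kermxP; exact: row_sub.
suff : w *m K = 0 by move=> /eqP; rewrite mulmx_free_eq0 // => /eqP.
apply/eqP/negPn/negP => /(gpos x).
rewrite /inner trmx_mul !mulmxA; move: wK0; rewrite !mulmxA => ->.
by rewrite mul0mx mxE ltxx.
Qed.

Lemma sharpP g (B : M -> 'M[R]_m) (X : M -> 'rV[R]_m) x Z : metric g ->
  (forall v, inner g x Z v = inner B x (X x) v) <-> Z = sharp g B X x.
Proof.
move=> gm; pose P := [set Z | forall v, inner g x Z v = inner B x (X x) v].
have PZ : P (sharp g B X x).
  apply: xgetPex; exists (X x *m B x *m invmx (g x)) => v.
  rewrite /inner mulmxKV //.
  have free1 : row_free (1%:M : 'M[R]_m) by rewrite row_free_unit unitmx1.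
  by have := gram_unit x gm free1; rewrite trmx1 mulmx1 mul1mx.
split=> [ZP|-> //]; apply: (inner_inj (x := x) gm) => w.
by rewrite ZP PZ.
Qed.

Lemma hprojP g x u h : metric g ->
  horizontal g x h /\ vertical x (u - h) <-> h = hproj g x u.
Proof.
move=> gm; have [hh vh] : horizontal g x (hproj g x u) /\
    vertical x (u - hproj g x u).
  apply: (@xgetPex _ 0 [set h | horizontal g x h /\ vertical x (u - h)]).
  pose K := row_base (kermx (differential pi x)).
  have Kunit : K *m g x *m K^T \in unitmx.
    by apply: gram_unit gm _; exact: row_base_free.
  have KE : (K :=: kermx (differential pi x))%MS by exact: eq_row_base.
  clearbody K.
  exists (u - u *m g x *m K^T *m invmx (K *m g x *m K^T) *m K); split.
    move=> v /sub_kermxP; rewrite -KE => /submxP[w ->].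
    rewrite /inner trmx_mul !mulmxA !mulmxBl.
    have -> : u *m g x *m K^T *m invmx (K *m g x *m K^T) *m K *m g x *m K^T =
              u *m g x *m K^T *m (invmx (K *m g x *m K^T) *m (K *m g x *m K^T)).
      by rewrite !mulmxA.
    by rewrite mulVmx // mulmx1 subrr mxE.
  rewrite subKr; apply/sub_kermxP; apply: submx_trans (submxMl _ _) _.
  by rewrite KE.
split=> [[hh' vh']|->//]; apply/eqP; rewrite -subr_eq0; apply/eqP.
apply: (horizontal_vertical0 gm (x := x)).
  by move=> v vv; rewrite innerBl hh' // hh // subrr.
move: vh vh'; rewrite /vertical /= !mulmxBl => /subr0_eq <- /subr0_eq <-.
by rewrite subrr.
Qed.

Lemma hliftP g (W : N -> 'rV[R]_p) x h : metric g ->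
  \rank (differential pi x) = p ->
  horizontal g x h /\ h *m differential pi x = W (pi x) <-> h = hlift g W x.
Proof.
move=> gm rk; have [hh lh] : horizontal g x (hlift g W x) /\
    hlift g W x *m differential pi x = W (pi x).
  apply: (@xgetPex _ 0 [set h | horizontal g x h /\
                                h *m differential pi x = W (pi x)]).
  pose w := W (pi x) *m pinvmx (differential pi x).
  have [hw vw] := (hprojP x w _ gm).2 erefl.
  exists (hproj g x w); split=> //.
  have wW : w *m differential pi x = W (pi x).
    by rewrite mulmxKpV // submx_full // /row_full rk.
  by move: vw; rewrite /vertical /= mulmxBl wW => /subr0_eq.
split=> [[hh' lh']|->//]; apply/eqP; rewrite -subr_eq0; apply/eqP.
apply: (horizontal_vertical0 gm (x := x)).
  by move=> v vv; rewrite innerBl hh' // hh // subrr.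
by rewrite /vertical /= mulmxBl lh lh' subrr.
Qed.

End Submersion.
End Geometry.

(* Main.v *)
(* A metric that agrees with g0 on the vertical bundle and makes pi a Riemannian
   submersion is determined by its pairing of vertical vectors with arbitrary
   vectors.  For an admissible family, [B_t(X, Y) = g_t(B_t^sharp X, Y)] with X
   vertical equals [sum_i g0(V_i, X) gN(W_i, pi_* Y) = g0(X, S Y)], where
   [S Y = sum_i gN(W_i, pi_* Y) V_i]: it does not depend on t.  Hence
   [g_t(X, Y) = g0(X, Y) + t g0(X, S Y)], and the solution is
   [g_t(Y, Z) = g0(Y + t S Y, Z + t S Z)], where [1 + t S] is invertible because
   S has vertical values and kills vertical vectors, so that [S^2 = 0].

   The hypotheses on admissible families only concern vertical fields, so
   uniqueness also requires that every vertical vector extends to a global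
   vertical field. *)
From HB Require Import structures.
Require Import Defs.
From mathcomp Require Import all_boot all_order all_algebra.
From mathcomp Require Import all_classical all_reals all_analysis.
From mathcomp Require Import ring.
Import Order.TTheory GRing.Theory Num.Theory.
Import numFieldNormedType.Exports.
(* Imported again, so that [coord] is not the coordinate of a vector. *)
Require Import Defs.
Local Open Scope classical_set_scope.
Local Open Scope ring_scope.
Set Implicit Arguments.
Unset Strict Implicit.
Unset Printing Implicit Defensive.

(** * Smooth functions on open subsets of row vectors *)

Section NearDifferentiable.
Variables (R : realType) (V W : normedModType R).

(** The first-order expansion at [a] only sees the germ, so ['d f a] also expands [g], and
    uniqueness of the differential identifies it with ['d g a]. This matters because [uncoord c]
    inverts [coord c] only near the points of a chart, so local expressions agree only as germs. *)
Lemma near_eq_differentiable_diff (f g : V -> W) (a : V) :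
  {near a, f =1 g} -> differentiable f a ->
  differentiable g a /\ 'd g a = 'd f a :> (V -> W).
Proof.
move=> fg df.
have gE : g \o shift a = cst (g a) + 'd f a +o_ 0 id.
  apply/eqaddoP => e e0; rewrite -(nbhs_singleton fg).
  have /eqaddoP/(_ _ e0) := diff_locally df.
  have shE : \forall x \near (0 : V), f (x + a) = g (x + a).
    by move: fg; rewrite (near_shift 0 a) /= subr0; apply: filterS => x /=.
  by apply: filterS2 shE => x; rewrite !fctE /= => ->.
have dE : 'd g a = 'd f a :> (V -> W).
  by apply: diff_unique => //; exact: diff_continuous.
split => //; apply/diff_locallyP; rewrite dE; split => //.
exact: diff_continuous.
Qed.

Lemma near_eq_differentiable (f g : V -> W) (a : V) :
  {near a, f =1 g} -> differentiable f a -> differentiable g a.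
Proof. by move=> fg /(near_eq_differentiable_diff fg)[]. Qed.

End NearDifferentiable.

Lemma mul_rV_jacobian (R : realType) m p (f : 'rV[R]_m -> 'rV[R]_p) z u :
  u *m 'J f z = 'd f z u.
Proof. by rewrite /jacobian mul_rV_lin1. Qed.

Lemma near_eq_jacobian (R : realType) m p (f g : 'rV[R]_m -> 'rV[R]_p) z :
  {near z, f =1 g} -> differentiable f z -> 'J g z = 'J f z.
Proof.
move=> fg df; have [_ dE] := near_eq_differentiable_diff fg df.
exact: (congr1 (fun h : 'rV[R]_m -> 'rV[R]_p => lin1_mx h) dE).
Qed.

(** Jacobians act on rows from the right, so the factors appear in the order of application. *)
Lemma jacobian_comp (R : realType) m p q (f : 'rV[R]_m -> 'rV[R]_p)
    (g : 'rV[R]_p -> 'rV[R]_q) z :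
  differentiable f z -> differentiable g (f z) ->
  'J (g \o f) z = 'J f z *m 'J g (f z).
Proof.
move=> df dg; apply/row_matrixP => i.
rewrite row_mul !rowE mul_rV_jacobian (mul_rV_jacobian f).
rewrite (mul_rV_jacobian g).
exact: (congr1 (fun h : 'rV[R]_m -> 'rV[R]_q => h _) (diff_comp df dg)).
Qed.

Lemma jacobian_id (R : realType) m (z : 'rV[R]_m) : 'J id z = 1%:M.
Proof.
apply/row_matrixP => i; rewrite !rowE mul_rV_jacobian mulmx1.
have [_ dE] := is_diff_id z.
exact: (congr1 (fun h : 'rV[R]_m -> 'rV[R]_m => h _) dE).
Qed.

(** * Finite orders of differentiability *)

Section FiniteOrder.
Variable R : realType.

(** Grading smoothness by order allows induction on [k]: the product and chain rules produce sums
    that the iterated derivatives in [smooth_on] do not split. Order [0] already asks for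
    differentiability, so [k] counts the partial derivatives that must be differentiable in turn. *)
Fixpoint Cn (k : nat) m (E : normedModType R) (U : set 'rV[R]_m)
    (f : 'rV[R]_m -> E) : Prop :=
  (forall z, U z -> differentiable f z) /\
  if k is k'.+1 then forall i : 'I_m, Cn k' U ('D_(delta_mx 0 i) f) else True.

Lemma Cn_differentiable k m (E : normedModType R) (U : set 'rV[R]_m)
    (f : 'rV[R]_m -> E) z : Cn k U f -> U z -> differentiable f z.
Proof. by case: k => [|k] [df _] /df. Qed.

(** [Cn] peels off the derivative taken first, which [foldr] places at the end of the list; hence
    [rcons] and the induction from the right. *)
Lemma smooth_onP m (E : normedModType R) (U : set 'rV[R]_m)
    (f : 'rV[R]_m -> E) : smooth_on U f <-> forall k, Cn k U f.
Proof.
split=> [fU k|fU s].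
  elim: k f fU => [|k IHk] f fU; first by split => // z /(fU [::]).
  split=> [z /(fU [::]) //|i]; apply: IHk => s z Uz.
  by have := fU (rcons s i) z Uz; rewrite foldr_rcons.
elim/last_ind: s f fU => [|s i IHs] f fU z Uz.
  exact: Cn_differentiable (fU 0%N) Uz.
by rewrite foldr_rcons; apply: IHs => // k; have [_] := fU k.+1; exact.
Qed.

Lemma smooth_differentiable m (E : normedModType R) (U : set 'rV[R]_m)
    (f : 'rV[R]_m -> E) z : smooth_on U f -> U z -> differentiable f z.
Proof. by move=> fU Uz; have := fU [::] z Uz. Qed.

Lemma smooth_derive m (E : normedModType R) (U : set 'rV[R]_m)
    (f : 'rV[R]_m -> E) i : smooth_on U f -> smooth_on U ('D_(delta_mx 0 i) f).
Proof.
by move=> fU s z Uz; have := fU (rcons s i) z Uz; rewrite foldr_rcons.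
Qed.

Lemma smooth_subset m (E : normedModType R) (U U' : set 'rV[R]_m)
    (f : 'rV[R]_m -> E) : U' `<=` U -> smooth_on U f -> smooth_on U' f.
Proof. by move=> sub fU s z /sub; exact: fU. Qed.

Section OpenDomain.
Variables (m : nat) (U : set 'rV[R]_m).
Hypothesis openU : open U.

(** Since [U] is open, agreement on [U] is agreement near each of its points, so all derivatives
    agree on [U] as well. *)
Lemma Cn_ext k (E : normedModType R) (f g : 'rV[R]_m -> E) :
  {in U, f =1 g} -> Cn k U f -> Cn k U g.
Proof.
have nearE (h h' : 'rV[R]_m -> E) z :
    {in U, h =1 h'} -> U z -> {near z, h =1 h'}.
  move=> hh' Uz; have : nbhs z U by exact: open_nbhs_nbhs.
  by apply: filterS => y Uy; apply: hh'; rewrite inE.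
have diffE (h h' : 'rV[R]_m -> E) z : {in U, h =1 h'} -> U z ->
    differentiable h z -> differentiable h' z.
  by move=> hh' Uz; exact: near_eq_differentiable (nearE _ _ _ hh' Uz).
elim: k f g => [|k IHk] f g fg [df Df].
  by split => // z Uz; apply: diffE fg Uz (df z Uz).
split=> [z Uz|i]; first by apply: diffE fg Uz (df z Uz).
apply: IHk (Df i) => z; rewrite inE => Uz.
exact: near_eq_derive (nearE _ _ _ fg Uz).
Qed.

Lemma CnW k (E : normedModType R) (f : 'rV[R]_m -> E) :
  Cn k.+1 U f -> Cn k U f.
Proof.
elim: k f => [|k IHk] f [df Df]; split => // i.
exact: IHk.
Qed.

Lemma Cn_cst k (E : normedModType R) (a : E) : Cn k U (fun=> a).
Proof.
elim: k a => [|k IHk] a.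
  by split => // z _; exact: differentiable_cst.
split=> [z _|i]; first exact: differentiable_cst.
apply: (@Cn_ext k _ (fun=> 0)) => [z _|]; last exact: IHk.
by rewrite derive_cst.
Qed.

Lemma CnD k (E : normedModType R) (f g : 'rV[R]_m -> E) :
  Cn k U f -> Cn k U g -> Cn k U (fun z => f z + g z).
Proof.
elim: k f g => [|k IHk] f g fU gU.
  split => // z Uz.
  by apply: differentiableD; apply: Cn_differentiable Uz; eassumption.
split=> [z Uz|i].
  by apply: differentiableD; apply: Cn_differentiable Uz; eassumption.
apply: Cn_ext (IHk _ _ (fU.2 i) (gU.2 i)) => z; rewrite inE => Uz.
rewrite [RHS]deriveD //; apply: diff_derivable;
  by apply: Cn_differentiable Uz; eassumption.
Qed.

Lemma CnM k (f g : 'rV[R]_m -> R) :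
  Cn k U f -> Cn k U g -> Cn k U (fun z => f z * g z).
Proof.
elim: k f g => [|k IHk] f g fU gU.
  split => // z Uz.
  by apply: differentiableM; apply: Cn_differentiable Uz; eassumption.
split=> [z Uz|i].
  by apply: differentiableM; apply: Cn_differentiable Uz; eassumption.
apply: Cn_ext (CnD (IHk _ _ (CnW fU) (gU.2 i)) (IHk _ _ (CnW gU) (fU.2 i))).
move=> z; rewrite inE => Uz.
rewrite [RHS]deriveM //; apply: diff_derivable;
  by apply: Cn_differentiable Uz; eassumption.
Qed.

(** A continuous linear map is its own differential, hence commutes with partial derivatives. *)
Lemma Cn_linear k (E E' : normedModType R) (L : {linear E -> E'})
    (f : 'rV[R]_m -> E) : continuous L -> Cn k U f -> Cn k U (L \o f).
Proof.
move=> Lc; have Ld y : differentiable L y by exact: linear_differentiable.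
elim: k f => [|k IHk] f fU.
  split => // z Uz.
  by apply: differentiable_comp => //; apply: Cn_differentiable Uz; eassumption.
have df z : U z -> differentiable f z.
  by move=> Uz; exact: Cn_differentiable fU Uz.
split=> [z Uz|i]; first by apply: differentiable_comp => //; exact: df.
apply: Cn_ext (IHk _ (fU.2 i)) => z; rewrite inE => Uz /=.
rewrite deriveE; last exact: df.
rewrite deriveE; last by apply: differentiable_comp => //; exact: df.
rewrite (diff_comp (df _ Uz) (Ld _)) /=.
by rewrite (diff_lin (f z) Lc).
Qed.

End OpenDomain.
End FiniteOrder.

(** * Closure properties of smooth functions *)

Section SmoothAlgebra.
Variables (R : realType) (m : nat) (U : set 'rV[R]_m).
Hypothesis openU : open U.

Lemma smooth_ext (E : normedModType R) (f g : 'rV[R]_m -> E) :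
  {in U, f =1 g} -> smooth_on U f -> smooth_on U g.
Proof.
move=> fg /smooth_onP fU; apply/smooth_onP => k.
exact: Cn_ext fg (fU k).
Qed.

Lemma smooth_cst (E : normedModType R) (a : E) : smooth_on U (fun=> a).
Proof. by apply/smooth_onP => k; exact: Cn_cst. Qed.

Lemma smoothD (E : normedModType R) (f g : 'rV[R]_m -> E) :
  smooth_on U f -> smooth_on U g -> smooth_on U (fun z => f z + g z).
Proof.
move=> /smooth_onP fU /smooth_onP gU; apply/smooth_onP => k.
exact: CnD (fU k) (gU k).
Qed.

Lemma smoothM (f g : 'rV[R]_m -> R) :
  smooth_on U f -> smooth_on U g -> smooth_on U (fun z => f z * g z).
Proof.
move=> /smooth_onP fU /smooth_onP gU; apply/smooth_onP => k.
exact: CnM (fU k) (gU k).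
Qed.

Lemma smooth_linear (E E' : normedModType R) (L : {linear E -> E'})
    (f : 'rV[R]_m -> E) :
  continuous L -> smooth_on U f -> smooth_on U (L \o f).
Proof.
move=> Lc /smooth_onP fU; apply/smooth_onP => k.
exact: Cn_linear Lc (fU k).
Qed.

Lemma smooth_id : smooth_on U (@id 'rV[R]_m).
Proof.
apply/smooth_onP => -[|k]; first by split => // z _; exact: ex_diff.
split=> [z _|i]; first exact: ex_diff.
apply: (Cn_ext openU (f := fun=> delta_mx 0 i)) => [z _|]; last exact: Cn_cst.
by rewrite derive_id.
Qed.

Lemma smoothN (f : 'rV[R]_m -> R) :
  smooth_on U f -> smooth_on U (fun z => - f z).
Proof.
move=> fU; apply: smooth_ext (smoothM (smooth_cst (-1 : R)) fU) => z _.
by rewrite mulN1r.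
Qed.

Lemma smooth_sum (E : normedModType R) (I : Type) (s : seq I) (P : pred I)
    (F : I -> 'rV[R]_m -> E) : (forall i, smooth_on U (F i)) ->
  smooth_on U (fun z => \sum_(i <- s | P i) F i z).
Proof.
move=> FU; elim: s => [|i s IHs].
  by apply: smooth_ext (smooth_cst 0) => z _; rewrite big_nil.
case Pi : (P i); last by apply: smooth_ext IHs => z _; rewrite big_cons Pi.
by apply: smooth_ext (smoothD (FU i) IHs) => z _; rewrite big_cons Pi.
Qed.

Lemma smooth_prod (I : Type) (s : seq I) (P : pred I)
    (F : I -> 'rV[R]_m -> R) : (forall i, smooth_on U (F i)) ->
  smooth_on U (fun z => \prod_(i <- s | P i) F i z).
Proof.
move=> FU; elim: s => [|i s IHs].
  by apply: smooth_ext (smooth_cst (1 : R)) => z _; rewrite big_nil.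
case Pi : (P i); last by apply: smooth_ext IHs => z _; rewrite big_cons Pi.
by apply: smooth_ext (smoothM (FU i) IHs) => z _; rewrite big_cons Pi.
Qed.

Lemma Cn_coord k a b (f : 'rV[R]_m -> 'M[R]_(a, b)) i j :
  Cn k U f -> Cn k U (fun z => f z i j).
Proof.
have @L : {linear 'M[R]_(a, b) -> R}.
  by exists (fun N : 'M[R]_(a, b) => N i j); do 2![eexists]; do ?[constructor];
     rewrite ?mxE// => ? *; rewrite ?mxE//; move=> ?; rewrite !mxE.
move=> fU; apply: (Cn_linear openU (L := L)) fU.
exact: matrix_normedtype.coord_continuous.
Qed.

(** Taking an entry is continuous and linear; conversely a matrix is the finite sum of its entries
    times constant elementary matrices. *)
Lemma smooth_mxP a b (f : 'rV[R]_m -> 'M[R]_(a, b)) :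
  smooth_on U f <-> forall i j, smooth_on U (fun z => f z i j).
Proof.
split=> [/smooth_onP fU i j|fU].
  by apply/smooth_onP => k; apply: Cn_coord; exact: fU.
have scaleU (h : 'rV[R]_m -> R) (A : 'M[R]_(a, b)) :
    smooth_on U h -> smooth_on U (fun z => h z *: A).
  have Llin : linear (fun x : R => x *: A).
    by move=> c x y; rewrite scalerDl scalerA.
  pose L : {linear R -> 'M[R]_(a, b)} :=
    HB.pack (fun x : R => x *: A) (GRing.isLinear.Build _ _ _ _ _ Llin).
  by apply: (smooth_linear (L := L)); exact: scalel_continuous.
apply: (@smooth_ext _ (fun z => \sum_i \sum_j f z i j *: delta_mx i j)).
  by move=> z _; rewrite -matrix_sum_delta.
by apply: smooth_sum => i; apply: smooth_sum => j; exact: scaleU.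
Qed.

Lemma smooth_mulmx a b c (f : 'rV[R]_m -> 'M[R]_(a, b))
    (g : 'rV[R]_m -> 'M[R]_(b, c)) :
  smooth_on U f -> smooth_on U g -> smooth_on U (fun z => f z *m g z).
Proof.
move=> /smooth_mxP fU /smooth_mxP gU; apply/smooth_mxP => i j.
apply: (@smooth_ext _ (fun z => \sum_k f z i k * g z k j)).
  by move=> z _; rewrite mxE.
by apply: smooth_sum => k; exact: smoothM.
Qed.

Lemma smooth_trmx a b (f : 'rV[R]_m -> 'M[R]_(a, b)) :
  smooth_on U f -> smooth_on U (fun z => (f z)^T).
Proof.
move=> /smooth_mxP fU; apply/smooth_mxP => i j.
by apply: smooth_ext (fU j i) => z _; rewrite mxE.
Qed.

Lemma smooth_scalemx a b (h : 'rV[R]_m -> R) (f : 'rV[R]_m -> 'M[R]_(a, b)) :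
  smooth_on U h -> smooth_on U f -> smooth_on U (fun z => h z *: f z).
Proof.
move=> hU /smooth_mxP fU; apply/smooth_mxP => i j.
by apply: smooth_ext (smoothM hU (fU i j)) => z _; rewrite mxE.
Qed.

Lemma smooth_det a (f : 'rV[R]_m -> 'M[R]_a) :
  smooth_on U f -> smooth_on U (fun z => \det (f z)).
Proof.
move=> /smooth_mxP fU; apply: smooth_sum => s.
by apply: smoothM; [exact: smooth_cst|apply: smooth_prod => i].
Qed.

Lemma smooth_adj a (f : 'rV[R]_m -> 'M[R]_a) :
  smooth_on U f -> smooth_on U (fun z => \adj (f z)).
Proof.
move=> /smooth_mxP fU; apply/smooth_mxP => i j.
apply: (@smooth_ext _ (fun z => cofactor (f z) j i)).
  by move=> z _; rewrite mxE.
apply: smoothM; first exact: smooth_cst.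
apply: smooth_det; apply/smooth_mxP => k l.
by apply: smooth_ext (fU (lift j k) (lift i l)) => z _; rewrite !mxE.
Qed.

Lemma smooth_jacobian p (f : 'rV[R]_m -> 'rV[R]_p) :
  smooth_on U f -> smooth_on U (fun z => 'J f z).
Proof.
move=> fU; apply/smooth_mxP => i j.
have /smooth_mxP/(_ 0 j) := smooth_derive i fU.
apply: smooth_ext => z; rewrite inE => Uz.
rewrite deriveEjacobian; last exact: smooth_differentiable fU Uz.
by rewrite -rowE mxE.
Qed.

Section Composition.
Variables (p : nat) (U' : set 'rV[R]_p) (phi : 'rV[R]_m -> 'rV[R]_p).
Hypothesis phiUU' : forall z, U z -> U' (phi z).

(** By the chain rule a partial derivative of [f \o phi] is a finite sum of products, each with a
    partial derivative of [f] again composed with [phi], to which the induction hypothesis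
    applies. *)
Lemma Cn_comp k (f : 'rV[R]_p -> R) :
  Cn k U' f -> Cn k U phi -> Cn k U (f \o phi).
Proof.
elim: k f => [|k IHk] f fU' phiU.
  split => // z Uz; apply: differentiable_comp.
    exact: Cn_differentiable phiU Uz.
  exact: Cn_differentiable fU' (phiUU' Uz).
have df z : U z -> differentiable f (phi z).
  by move=> Uz; exact: Cn_differentiable fU' (phiUU' Uz).
have dphi z : U z -> differentiable phi z.
  by move=> Uz; exact: Cn_differentiable phiU Uz.
split=> [z Uz|i]; first by apply: differentiable_comp; [exact: dphi|exact: df].
apply: (Cn_ext openU (f := fun z =>
    \sum_j ('D_(delta_mx 0 i) phi z) 0 j * ('D_(delta_mx 0 j) f \o phi) z)).
  move=> z; rewrite inE => Uz.
  rewrite [RHS]deriveE; last first.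
    by apply: differentiable_comp; [exact: dphi|exact: df].
  rewrite (diff_comp (dphi _ Uz) (df _ Uz)) /= -(deriveE _ (dphi _ Uz)).
  set w := 'D_(delta_mx 0 i) phi z.
  rewrite [in RHS](row_sum_delta w) linear_sum.
  apply: eq_bigr => j _; rewrite linearZ /= (deriveE _ (df _ Uz)) //.
have : forall j : 'I_p, Cn k U (fun z => ('D_(delta_mx 0 i) phi z) 0 j *
    ('D_(delta_mx 0 j) f \o phi) z).
  move=> j; apply: CnM => //; first by apply: Cn_coord; exact: phiU.2.
  by apply: IHk; [exact: fU'.2|exact: CnW].
elim: (index_enum _) => [|j s IHs] FU.
  apply: (Cn_ext openU (f := fun=> 0)) (Cn_cst openU k 0) => z _.
  by rewrite big_nil.
apply: (Cn_ext openU) (CnD openU (FU j) (IHs FU)) => z _.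
by rewrite big_cons.
Qed.

Lemma smooth_comp (f : 'rV[R]_p -> R) :
  smooth_on U' f -> smooth_on U phi -> smooth_on U (f \o phi).
Proof.
move=> /smooth_onP fU' /smooth_onP phiU; apply/smooth_onP => k.
exact: Cn_comp.
Qed.

End Composition.
End SmoothAlgebra.

Arguments smooth_cst {R m U} openU {E} a.

Lemma smooth_comp_mx (R : realType) m p a b (U : set 'rV[R]_m)
    (U' : set 'rV[R]_p) (phi : 'rV[R]_m -> 'rV[R]_p)
    (f : 'rV[R]_p -> 'M[R]_(a, b)) :
  open U -> open U' -> (forall z, U z -> U' (phi z)) ->
  smooth_on U' f -> smooth_on U phi -> smooth_on U (fun z => f (phi z)).
Proof.
move=> openU openU' UU' /(smooth_mxP openU') fU' phiU.
apply/(smooth_mxP openU) => i j.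
exact: (smooth_comp openU UU' (fU' i j) phiU).
Qed.

(** * Bump functions *)

Section Bump.
Variable R : realType.
Implicit Types (p : {poly R}) (t : R).

(* The polynomial factor makes the family closed under derivation. *)
Definition flat p t : R := if 0 < t then p.[t^-1] * expR (- t^-1) else 0.

Lemma flat_le0 p t : t <= 0 -> flat p t = 0.
Proof. by rewrite /flat ltNge => ->. Qed.

(** Each monomial satisfies [s ^+ i <= i! * expR s] by the exponential series; the added [1] keeps
    [C] positive when [p] is zero. *)
Lemma horner_expR_bound p :
  exists2 C : R, 0 < C & forall s, 0 <= s -> `|p.[s]| <= C * expR s.
Proof.
exists (\sum_(i < size p) `|p`_i| * i`!%:R + 1).
  by rewrite ltr_wpDl // sumr_ge0 // => i _; rewrite mulr_ge0.
move=> s s0; rewrite mulrDl mul1r ler_wpDr ?expR_ge0 //.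
rewrite horner_coef (le_trans (ler_norm_sum _ _ _)) // mulr_suml.
apply: ler_sum => i _; rewrite normrM -mulrA ler_wpM2l //.
rewrite ger0_norm ?exprn_ge0 //.
case: {i}(nat_of_ord i) => [|i].
  by rewrite expr0 fact0 mul1r -expR0 ler_expR.
rewrite -ler_pdivrMl ?ltr0n ?fact_gt0 // mulrC.
by apply: le_trans (expR_ge1Dxn i s0); rewrite lerDr.
Qed.

(** The exponential bound for [p * 'X^2] at [t^-1] leaves a factor [t ^+ 2] to spare, which will
    make the derivative at [0] vanish. *)
Lemma flat_bound p : exists2 C : R, 0 < C & forall t, `|flat p t| <= C * t ^+ 2.
Proof.
have [C C0 pC] := horner_expR_bound (p * 'X^2).
exists C => // t; rewrite /flat; case: ifPn => [t0|_]; last first.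
  by rewrite normr0 mulr_ge0 ?sqr_ge0 // ltW.
have ti0 : 0 <= t^-1 by rewrite invr_ge0 ltW.
have := pC _ ti0.
rewrite hornerM hornerXn normrM (ger0_norm (exprn_ge0 2 ti0)) => h.
rewrite normrM (ger0_norm (expR_ge0 _)).
rewrite expRN ler_pdivrMr ?expR_gt0 // mulrAC.
by rewrite -ler_pdivrMr ?exprn_gt0 // -exprVn.
Qed.

Lemma is_derive_flat p t :
  is_derive t (1 : R) (flat p) (flat ('X^2 * (p - p^`()%R)) t).
Proof.
have [t0|t0|<-] := ltgtP 0 t.
- apply: (near_eq_is_derive (f := (horner p \o (fun x => x^-1)) *
      (expR \o (fun x => - x^-1)))).
    near=> x; rewrite /flat ifT //; near: x; exact: lt_nbhsr.
  have dV : is_derive t (1 : R) (fun x : R => x^-1) (- (t ^- 2)).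
    have tn0 : id t != 0 by rewrite gt_eqF.
    apply: is_derive_eq (is_deriveV tn0 (is_derive_id t 1)) _.
    by rewrite [LHS]mulr1.
  have dN : is_derive t (1 : R) (fun x : R => - x^-1) (t ^- 2).
    by apply: is_derive_eq (is_deriveN dV) _; rewrite opprK.
  have dp := is_derive1_comp (is_derive_poly p t^-1) dV.
  have de := is_derive1_comp (g := fun x : R => - x^-1)
    (is_derive_expR (- t^-1)) dN.
  apply: is_derive_eq (is_deriveM dp de) _.
  rewrite /flat t0 hornerM hornerXn !hornerE /= -exprVn.
  rewrite -![_ *: _]/(_ * _); ring.
- rewrite flat_le0 ?(ltW t0) //.
  apply: (near_eq_is_derive (f := cst 0)).
  near=> x; rewrite flat_le0 //; near: x; exact: lt_le_nbhsl.
- rewrite flat_le0 //; have [C C0 pC] := flat_bound p.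
  suff cv : h^-1 *: ((flat p \o shift 0) (h *: (1 : R)) - flat p 0)
      @[h --> (0 : R)^'] --> (0 : R).
    by apply: DeriveDef; [apply/cvg_ex; exists 0|exact/cvg_lim].
  apply/cvgrPdist_le => e e0; near=> h.
  have h0 : h != 0 by near: h; exact: nbhs_dnbhs_neq.
  rewrite /= sub0r normrN addr0 [h *: 1]mulr1 (@flat_le0 _ 0) // subr0.
  rewrite normrM normfV.
  rewrite ler_pdivrMl ?normr_gt0 // (le_trans (pC h)) //.
  have -> : C * h ^+ 2 = `|h| * (C * `|h|).
    by rewrite -(real_normK (num_real h)); ring.
  rewrite ler_wpM2l // -ler_pdivlMl //.
  near: h; apply: dnbhs0_le; rewrite mulr_gt0 ?invr_gt0 //.
Unshelve. all: by end_near. Qed.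

Section Composition.
Variables (m : nat) (U : set 'rV[R]_m).
Hypothesis openU : open U.

(** The derivative of a [flat] function is a [flat] function for another polynomial, so the
    induction on the order runs over all [p]. *)
Lemma smooth_flat p (q : 'rV[R]_m -> R) :
  smooth_on U q -> smooth_on U (flat p \o q).
Proof.
move=> /smooth_onP qU; apply/smooth_onP => k; elim: k p => [|k IHk] p.
  split => // z Uz; apply: differentiable_comp.
    exact: Cn_differentiable (qU 0%N) Uz.
  by apply/derivable1_diffP; have [] := is_derive_flat p (q z).
have df t : differentiable (flat p) t.
  by apply/derivable1_diffP; have [] := is_derive_flat p t.
have dq z : U z -> differentiable q z.
  by move=> Uz; exact: Cn_differentiable (qU 0%N) Uz.
split=> [z Uz|i]; first by apply: differentiable_comp => //; exact: dq.
apply: (Cn_ext openU) (CnM openU (IHk ('X^2 * (p - p^`()%R))) ((qU k.+1).2 i)).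
move=> z; rewrite inE => Uz.
rewrite [RHS]deriveE; last by apply: differentiable_comp => //; exact: dq.
rewrite (diff_comp (dq _ Uz) (df _)) /= -(deriveE _ (dq _ Uz)).
have <- : 'D_1 (flat p) (q z) = flat ('X^2 * (p - p^`()%R)) (q z).
  by have [] := is_derive_flat p (q z).
rewrite (deriveE _ (df _)).
by rewrite -[X in _ = 'd _ _ X]mulr1 linearZ /= [LHS]mulrC.
Qed.

End Composition.

(** The support is enclosed in a compact set so that its image in a Hausdorff manifold is closed,
    which permits extension by zero. *)
Lemma bump_function m (z0 : 'rV[R]_m) (O : set 'rV[R]_m) : nbhs z0 O ->
  exists b : 'rV[R]_m -> R, [/\ smooth_on setT b, b z0 != 0
    & exists K : set 'rV[R]_m,
        [/\ compact K, K `<=` O & forall z, ~ K z -> b z = 0]].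
Proof.
move=> /nbhs_ballP[e /= e0 eO]; pose r := e / 2.
have oT : open [set: 'rV[R]_m] by exact: openT.
have r0 : 0 < r by rewrite divr_gt0.
(* The squared Euclidean distance is polynomial, unlike the max norm that defines the balls. *)
pose q (z : 'rV[R]_m) := r ^+ 2 - \sum_i (z 0 i - z0 0 i) ^+ 2.
have qU : smooth_on setT q.
  rewrite /q; apply: (smoothD oT (smooth_cst oT _)); apply: (smoothN oT).
  apply: (smooth_sum oT) => i.
  have zi : smooth_on setT (fun z : 'rV[R]_m => z 0 i - z0 0 i).
    apply: (smoothD oT); last exact: (smooth_cst oT).
    by have /(smooth_mxP oT) := smooth_id oT; exact.
  exact: (smoothM oT zi zi).
exists (flat 1 \o q); split.
- exact: smooth_flat oT 1 _ qU.
- rewrite /= /q big1 ?subr0 => [|i _]; last by rewrite subrr expr0n.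
  by rewrite /flat exprn_gt0 // hornerC mul1r gt_eqF ?expR_gt0.
exists (closed_ball_ Num.norm z0 r); split.
- apply: bounded_closed_compact; last exact: closed_closed_ball_.
  exists (`|z0| + r); split; first exact: num_real.
  move=> M ltM z /= zr; apply: le_trans (ltW ltM).
  rewrite -[z](subKr z0) (le_trans (ler_normB _ _)) // lerD2l.
  by rewrite -[leLHS]/(`|z0 - z|).
- move=> z /= zr; apply: eO; rewrite -ball_normE /=.
  by rewrite (le_lt_trans zr) // ltr_pdivrMr // ltr_pMr // ltr1n.
- move=> z /= zr; apply: flat_le0; rewrite subr_le0; apply/ltW.
  (* Outside the max-norm ball one coordinate alone already makes [q] negative. *)
  have [i zi] : exists i, r < `|z 0 i - z0 0 i|.
    apply/not_existsP => zi; apply: zr.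
    rewrite /closed_ball_ /= [leLHS]/Num.norm /= mx_normrE.
    apply: bigmax_le; first exact: ltW.
    move=> [i j] _ /=; rewrite ord1 !mxE distrC leNgt; apply/negP; exact: zi.
  rewrite (bigD1 i) //= -[(z 0 i - _) ^+ 2]real_normK ?num_real //.
  rewrite ltr_wpDr ?ltrXn2r //.
    by rewrite sumr_ge0 // => j _; exact: sqr_ge0.
  by rewrite ltW.
Qed.

End Bump.

(** * Charts, local expressions and vertical fields *)

Section Charts.
Variables (R : realType) (m : nat) (M : manifold R m).
Implicit Types (c d e : chart M) (x : M).

Lemma coord_image_open c (A : set M) :
  open A -> open (coord c @` (dom c `&` A)).
Proof.
move=> openA; rewrite openE => z [x [cx Ax] <-].
have nD : nbhs (coord c x) (coord c @` dom c).
  by apply: open_nbhs_nbhs; split; [exact: coord_open|exists x].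
have nA : nbhs (coord c x) (uncoord c @^-1` A).
  apply: (uncoord_continuous cx); rewrite coordK //.
  exact: open_nbhs_nbhs.
apply: filterS2 nD nA => y [x' cx' <-] /=; rewrite coordK // => Ax'.
by exists x'.
Qed.

Lemma coord_image_near c x (P : M -> Prop) : dom c x -> nbhs x P ->
  \forall z \near coord c x, P (uncoord c z).
Proof.
by move=> cx nP; apply: (uncoord_continuous cx); rewrite coordK.
Qed.

Lemma dom_nbhs c x : dom c x -> nbhs x (dom c).
Proof. by move=> cx; apply: open_nbhs_nbhs; split => //; exact: dom_open. Qed.

Lemma transition_differentiable c d x : dom c x -> dom d x ->
  differentiable (coord d \o uncoord c) (coord c x).
Proof.
move=> cx dx; apply: smooth_differentiable (@transition_smooth _ _ M c d) _.
by exists x.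
Qed.

Lemma transition_refl c x : dom c x -> transition c c x = 1%:M.
Proof.
move=> cx; rewrite /transition -(jacobian_id (coord c x)).
apply: near_eq_jacobian; last exact: ex_diff.
have nD : nbhs (coord c x) (coord c @` dom c).
  by apply: open_nbhs_nbhs; split; [exact: coord_open|exists x].
by apply: filterS nD => z [y cy <-] /=; rewrite coordK.
Qed.

Lemma transition_trans c d e x : dom c x -> dom d x -> dom e x ->
  transition c d x *m transition d e x = transition c e x.
Proof.
move=> cx dx ex; rewrite /transition.
have := @jacobian_comp _ _ _ _ _ (coord e \o uncoord d) _
  (transition_differentiable cx dx).
rewrite /= coordK // => <-; last exact: transition_differentiable.
apply: near_eq_jacobian; last exact: transition_differentiable.
have := coord_image_near cx (dom_nbhs dx).
by apply: filterS => z /= dz; rewrite coordK.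
Qed.

Lemma transition_inv c d x : dom c x -> dom d x ->
  transition c d x *m transition d c x = 1%:M.
Proof. by move=> cx dx; rewrite transition_trans // transition_refl. Qed.

End Charts.

(** * Local expressions of a smooth map and extension of vertical vectors *)

Section SmoothMap.
Variables (R : realType) (m p : nat) (M : manifold R m) (N : manifold R p).
Variables (pi : M -> N).
Hypothesis pi_smooth : smooth_map pi.
Implicit Types (c : chart M) (d : chart N) (x : M).

Definition local_map c d := coord d \o pi \o uncoord c.

Definition local_dom c d := coord c @` (dom c `&` pi @^-1` dom d).

Lemma local_domain_open d : open (pi @^-1` dom d).
Proof.
have [pi_cont _] := pi_smooth.
by apply: open_comp => [x _|]; [exact: pi_cont|exact: dom_open].
Qed.

Lemma local_dom_open c d : open (local_dom c d).
Proof. by apply: coord_image_open; exact: local_domain_open. Qed.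
Arguments local_dom_open : clear implicits.

Lemma local_map_smooth c d : smooth_on (local_dom c d) (local_map c d).
Proof. by have [_] := pi_smooth; exact. Qed.
Arguments local_map_smooth : clear implicits.

Lemma local_map_differentiable c d x : dom c x -> dom d (pi x) ->
  differentiable (local_map c d) (coord c x).
Proof.
move=> cx dx; apply: smooth_differentiable (local_map_smooth c d) _.
by exists x.
Qed.

(** The charts [chart_at] are arbitrary at each point, so [differential pi] need not vary smoothly
    in [x]; smoothness arguments go through the Jacobian in fixed charts. The formula is the chain
    rule applied once on the source and once on the target. *)
Lemma jacobian_local_map c d x : dom c x -> dom d (pi x) ->
  'J (local_map c d) (coord c x) =
  transition c (chart_at x) x *m differential pi x
    *m transition (chart_at (pi x)) d (pi x).
Proof.
move=> cx dx; set c' := chart_at x; set d' := chart_at (pi x).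
have cx' : dom c' x by exact: dom_chart_at.
have dx' : dom d' (pi x) by exact: dom_chart_at.
have -> : differential pi x = 'J (local_map c' d') (coord c' x) by [].
have := @jacobian_comp _ _ _ _ _ (local_map c' d') _
  (transition_differentiable cx cx').
rewrite /= coordK // => <-; last exact: local_map_differentiable.
have -> : 'J (local_map c' d' \o (coord c' \o uncoord c)) (coord c x) =
    'J (local_map c d') (coord c x).
  apply: near_eq_jacobian; last exact: local_map_differentiable.
  apply: filterS (coord_image_near cx (dom_nbhs cx')) => z /= cz.
  by rewrite /local_map /= coordK.
have := @jacobian_comp _ _ _ _ _ (coord d \o uncoord d') _
  (local_map_differentiable cx dx').
rewrite /local_map /= !coordK // => <-; last exact: transition_differentiable.
apply/esym; apply: near_eq_jacobian; last exact: local_map_differentiable.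
have nd : nbhs x (pi @^-1` dom d').
  by apply: open_nbhs_nbhs; split => //; exact: local_domain_open.
apply: filterS (coord_image_near cx nd) => z /= dz.
by rewrite coordK.
Qed.

Lemma smooth_local_pullback a b (F : 'rV[R]_p -> 'M[R]_(a, b)) c d :
  smooth_on (coord d @` dom d) F ->
  smooth_on (local_dom c d) (fun z => F (local_map c d z)).
Proof.
move=> Fd.
apply: (smooth_comp_mx (local_dom_open c d) (@coord_open _ _ _ d) _ Fd
  (local_map_smooth c d)) => z [x [cx dx] <-].
by rewrite /local_map /= coordK //; exists (pi x).
Qed.

(** In one pair of charts, [v] is carried into the kernels of nearby Jacobians by a smooth matrix; a
    bump function then cuts the field off and allows extension by zero. *)
Lemma vertical_extension x v : \rank (differential pi x) = p ->
  vertical pi x v -> exists2 X, vertical_field pi X & X x = v.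
Proof.
move=> rkp vv; set c := chart_at x; set d := chart_at (pi x).
have cx : dom c x by exact: dom_chart_at.
have dx : dom d (pi x) by exact: dom_chart_at.
set z0 := coord c x.
pose J z := 'J (local_map c d) z.
have J0 : J z0 = differential pi x by [].
(* [Q z] is the multiple by [\det (A z)] of a projection onto the left kernel of
   [J z]; it is smooth because it is polynomial in the entries of [J z]. *)
pose A z := pinvmx (J z0) *m J z.
(* Full rank makes [pinvmx (J z0)] a left inverse of [J z0]. *)
have A0 : A z0 = 1%:M by rewrite /A mulVpmx // /row_full J0 rkp.
pose Q z := \det (A z) *: 1%:M - J z *m \adj (A z) *m pinvmx (J z0).
(* Since [\adj (A z) *m A z] is [\det (A z)] times the identity, this holds even where [A z] is
   singular. *)
have QJ z : Q z *m J z = 0.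
  rewrite /Q mulmxBl -[_ *m pinvmx _ *m _]mulmxA -/(A z) -mulmxA mul_adj_mx.
  rewrite mul_mx_scalar -scalemxAl mul1mx.
  by rewrite subrr.
have vQ : v *m Q z0 = v.
  rewrite /Q A0 det1 scale1r mulmxBr mulmx1 !mulmxA J0.
  by have -> : v *m differential pi x = 0; rewrite ?mul0mx ?subr0.
pose U := dom c `&` pi @^-1` dom d.
have openU : open U by apply: openI; [exact: dom_open|exact: local_domain_open].
have [b [b_smooth b0 [K [Kcompact KU bK]]]] :
    exists b : 'rV[R]_m -> R, [/\ smooth_on setT b, b z0 != 0
      & exists K : set 'rV[R]_m,
        [/\ compact K, K `<=` local_dom c d & forall z, ~ K z -> b z = 0]].
  apply: bump_function; apply: open_nbhs_nbhs.
  split; first exact: local_dom_open.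
  by exists x.
pose K' := uncoord c @` K.
have K'closed : closed K'.
  apply: compact_closed; first exact: space_hausdorff.
  apply: continuous_compact => //; apply: continuous_in_subspaceT => z.
  rewrite inE => /KU[y [cy _] <-].
  exact: uncoord_continuous.
have bK' y : dom c y -> ~ K' y -> b (coord c y) = 0.
  move=> cy K'y; apply: bK => Ky; apply: K'y.
  by exists (coord c y); rewrite ?coordK.
have K'U y : K' y -> U y.
  by move=> [z /KU[y' [cy' dy'] <-] <-]; rewrite coordK.
pose Y z := ((b z0)^-1 * b z) *: (v *m Q z).
(* [Y] has components in the chart [c], whereas a tangent vector at [y] is recorded in
   [chart_at y]. *)
pose X y :=
  if `[< U y >] then Y (coord c y) *m transition c (chart_at y) y else 0.
have Y_smooth : smooth_on (local_dom c d) Y.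
  have o := local_dom_open c d.
  have J_smooth : smooth_on (local_dom c d) J.
    by apply: (smooth_jacobian o); exact: local_map_smooth.
  have A_smooth : smooth_on (local_dom c d) A.
    by apply: (smooth_mulmx o) => //; exact: (smooth_cst o).
  apply: (smooth_scalemx o).
    apply: (smoothM o); first exact: (smooth_cst o).
    by apply: smooth_subset b_smooth.
  apply: (smooth_mulmx o); first exact: (smooth_cst o).
  apply: (smoothD o).
    by apply: (smooth_scalemx o); [exact: (smooth_det o)|exact: (smooth_cst o)].
  have adj_smooth := smooth_adj o A_smooth.
  have := smooth_mulmx o (smooth_mulmx o J_smooth adj_smooth)
    (smooth_cst o (- pinvmx (J z0))).
  by apply: (smooth_ext o) => z _; rewrite mulmxN.
have XE c' y : dom c' y -> U y ->
    X y *m transition (chart_at y) c' y = Y (coord c y) *m transition c c' y.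
  move=> cy' Uy; have [cy _] := Uy; have cy'' := dom_chart_at y.
  by rewrite /X (asboolT Uy) -mulmxA (transition_trans cy cy'' cy').
exists X; last first.
  have Ux : U x by split.
  rewrite /X (asboolT Ux).
  by rewrite transition_refl // mulmx1 /Y vQ mulVf // scale1r.
split=> [c'|y]; last first.
  rewrite /X; case: asboolP => [[cy dy]|_]; last by rewrite /vertical /= mul0mx.
  rewrite /vertical /= -mulmxA.
  (* [Y] lies in the kernel of the Jacobian in the charts [c] and [d]; the invertible target
     transition is then cancelled to reach [differential pi y]. *)
  have := jacobian_local_map cy dy.
  move=> /(congr1 (mulmx (Y (coord c y)))).
  rewrite -scalemxAl -!mulmxA QJ mulmx0 scaler0.
  move=> /(congr1 (mulmxr (transition d (chart_at (pi y)) (pi y)))) /=.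
  rewrite mul0mx -!mulmxA transition_inv ?mulmx1 //; exact: dom_chart_at.
move=> s z [y cy' <-].
(* [U] and the complement of [K'] are open and cover [M], because [K'] lies in [U]. On the first,
   [X] is [Y] read in the chart [c']; on the second, [X] is zero. *)
have [Uy|nUy] := pselect (U y).
  have o : open (coord c' @` (dom c' `&` U)) by exact: coord_image_open.
  suff h : smooth_on (coord c' @` (dom c' `&` U))
      (fun z => Y ((coord c \o uncoord c') z) *m
        'J (coord c' \o uncoord c) ((coord c \o uncoord c') z)).
    apply: (smooth_ext o _ h) => [w|]; last by exists y.
    rewrite inE => -[y' [cy'' Uy'] <-] /=.
    by rewrite (coordK cy'') -/(transition c c' y') (XE _ _ cy'' Uy').
  have cc' : smooth_on (coord c' @` (dom c' `&` U)) (coord c \o uncoord c').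
    apply: smooth_subset (@transition_smooth _ _ M c' c) => w [y' [? [? _]] <-].
    by exists y'.
  apply: (smooth_mulmx o).
    apply: (smooth_comp_mx o (local_dom_open c d) _ Y_smooth cc').
    by move=> w [y' [? ?] <-] /=; rewrite coordK //; exists y'.
  have o' := @coord_image_open _ _ M c _ (@dom_open _ _ M c').
  apply: (smooth_comp_mx o o' _ _ cc').
    by move=> w [y' [? [? _]] <-] /=; rewrite coordK //; exists y'.
  by apply: (smooth_jacobian o'); exact: transition_smooth.
have o : open (coord c' @` (dom c' `&` ~` K')).
  by apply: coord_image_open; exact: closed_openC.
apply: (smooth_ext o _ (smooth_cst o 0)) => [w|]; last first.
  by exists y => //; split => // /K'U.
rewrite inE => -[y' [cy'' K'y'] <-] /=; rewrite coordK //.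
rewrite /X; case: asboolP => [[cy _]|_]; last by rewrite mul0mx.
by rewrite /Y bK' // mulr0 scale0r !mul0mx.
Qed.

End SmoothMap.

Arguments local_dom_open {R m p M N pi} pi_smooth c d.
Arguments local_map_smooth {R m p M N pi} pi_smooth c d.
Arguments smooth_local_pullback {R m p M N pi} pi_smooth {a b F} c d.

(** * Metrics and submersions *)

Section Inner.
Variables (R : realType) (m : nat) (M : manifold R m).
Implicit Types (g : M -> 'M[R]_m) (x : M) (u v w : 'rV[R]_m).

Lemma innerDl g x u v w : inner g x (u + v) w = inner g x u w + inner g x v w.
Proof. by rewrite /inner !mulmxDl !mxE. Qed.

Lemma innerDr g x u v w : inner g x u (v + w) = inner g x u v + inner g x u w.
Proof. by rewrite /inner linearD /= mulmxDr !mxE. Qed.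

Lemma innerZl g x a u v : inner g x (a *: u) v = a * inner g x u v.
Proof. by rewrite /inner -!scalemxAl mxE. Qed.

Lemma innerZr g x a u v : inner g x u (a *: v) = a * inner g x u v.
Proof. by rewrite /inner linearZ /= -scalemxAr mxE. Qed.

Lemma inner_suml g x (I : finType) (F : I -> 'rV[R]_m) v :
  inner g x (\sum_i F i) v = \sum_i inner g x (F i) v.
Proof. by rewrite /inner !mulmx_suml summxE. Qed.

Lemma inner_delta g x i j : inner g x (delta_mx 0 i) (delta_mx 0 j) = g x i j.
Proof. by rewrite /inner trmx_delta -rowE -colE !mxE. Qed.

Lemma is_derive_inner (g : R -> M -> 'M[R]_m) x t u v :
  derivable (fun s => g s x) t 1 ->
  is_derive t 1 (fun s => inner (g s) x u v) (inner (dt g t) x u v).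
Proof.
move=> dg.
have dgE : dt g t x = \matrix_(i, j) 'D_1 (fun s => g s x i j) t.
  by rewrite /dt derive1E derive_mx.
have dgij i j : is_derive t 1 (fun s => g s x i j) (dt g t x i j).
  by apply: DeriveDef; [exact: (derivable_mxP _ _ _).1|rewrite dgE mxE].
have innerE (f : M -> 'M[R]_m) :
    inner f x u v = \sum_j \sum_i (u 0 i * v 0 j) * f x i j.
  rewrite /inner mxE; apply: eq_bigr => j _; rewrite !mxE mulr_suml.
  by apply: eq_bigr => i _; rewrite mulrAC.
have -> : (fun s => inner (g s) x u v) =
    \sum_j \sum_i ((u 0 i * v 0 j) \*: (fun s => g s x i j)).
  apply/funext => s; rewrite innerE fct_sumE; apply: eq_bigr => j _.
  by rewrite fct_sumE.
rewrite innerE; apply: is_derive_sum => j; apply: is_derive_sum.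
Qed.

End Inner.

(** * Differentiation and integration in time *)

Lemma is_derive_scalel (R : realType) (E : normedModType R) (k : R -> R) (A : E)
    (t k' : R) :
  is_derive t 1 k k' -> is_derive t 1 (fun s => k s *: A) (k' *: A).
Proof.
move=> [dk <-]; have fk : differentiable k t by exact/derivable1_diffP.
have fkA : differentiable (fun s => k s *: A) t by exact: differentiableZl.
apply: DeriveDef; first exact: diff_derivable.
by rewrite (deriveE _ fkA) (diffZl _ fk) (deriveE _ fk).
Qed.

(** Mean value theorem between [0] and [t], on either side: the unknown intermediate point is
    harmless because the derivative is constant. *)
Lemma constant_derive_affine (R : realType) (f : R -> R) (e c t : R) :
  (forall s : R, `|s| < e -> is_derive s 1 f c) ->
  `|t| < e -> f t = f 0 + t * c.
Proof.
move=> df te.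
have cont a b : `|a| < e -> `|b| < e -> {within `[a, b], continuous f}.
  move=> ae be; apply: derivable_within_continuous => s /itvP sab.
  have /df[] // : `|s| < e.
  move: ae be; rewrite !ltr_norml => /andP[ae _] /andP[_ be].
  by rewrite (lt_le_trans ae) ?sab // (le_lt_trans _ be) ?sab.
have e0 : `|0 : R| < e by rewrite normr0; apply: le_lt_trans te.
have dfab a b s : `|a| < e -> `|b| < e -> s \in `]a, b[ -> is_derive s 1 f c.
  move=> ae be /itvP sab; apply: df.
  move: ae be; rewrite !ltr_norml => /andP[ae _] /andP[_ be].
  by rewrite (lt_trans ae) ?sab // (lt_trans _ be) ?sab.
have [t0|/ltW t0] := leP 0 t.
  have [_ _ E] := MVT_segment t0 (fun s => @dfab 0 t s e0 te) (cont _ _ e0 te).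
  by apply/eqP; rewrite addrC -subr_eq E subr0 mulrC.
have [_ _ E] := MVT_segment t0 (fun s => @dfab t 0 s te e0) (cont _ _ te e0).
move: E; rewrite sub0r mulrN (mulrC c) => /(congr1 -%R); rewrite opprK => <-.
by rewrite opprB addrC subrK.
Qed.

(** * Metrics making [pi] a Riemannian submersion *)

Section Submersions.
Variables (R : realType) (m p : nat) (M : manifold R m) (N : manifold R p).
Variables (pi : M -> N) (gN : N -> 'M[R]_p).
Implicit Types (g h : M -> 'M[R]_m) (x : M) (u v w : 'rV[R]_m).

(** A horizontal vector does not see the vertical part of [v], and horizontal projection preserves
    images under [pi]. The right-hand side no longer involves [g], which is the source of
    independence of time. *)
Lemma inner_hproj g x u v : metric g -> riemannian_submersion pi g gN ->
  inner g x (hproj pi g x u) v =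
  inner gN (pi x) (u *m differential pi x) (v *m differential pi x).
Proof.
move=> gm [_ _ gpi].
have projD w : hproj pi g x w *m differential pi x = w *m differential pi x.
  have [_ vw] := (hprojP pi x w _ gm).2 erefl.
  by apply/esym/subr0_eq; rewrite -mulmxBl.
have hor w : horizontal pi g x (hproj pi g x w).
  by have [] := (hprojP pi x w _ gm).2 erefl.
rewrite -(projD u) -(projD v) -(gpi x) //.
rewrite -[in LHS](subrK (hproj pi g x v) v) innerDr (hor u) ?add0r //.
by have [] := (hprojP pi x v _ gm).2 erefl.
Qed.

(** Pairings with vertical vectors fix the horizontal space, hence the projection [hproj]. After
    splitting [u], its vertical part pairs equally by hypothesis and its horizontal part pairs
    through [gN]. *)
Lemma submersion_metric_eq g h x : metric g -> metric h ->
  riemannian_submersion pi g gN -> riemannian_submersion pi h gN ->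
  (forall v u, vertical pi x v -> inner g x v u = inner h x v u) -> g x = h x.
Proof.
move=> gm hm gpi hpi gh.
have ghr u v : vertical pi x v -> inner g x u v = inner h x u v.
  by move=> vv; have [gs _ _] := gm; have [hs _ _] := hm; rewrite gs hs gh.
have projE u : hproj pi g x u = hproj pi h x u.
  apply/(hprojP pi x u _ hm); have [hor ver] := (hprojP pi x u _ gm).2 erefl.
  by split=> // v vv; rewrite -ghr // hor.
apply/matrixP => i j; rewrite -!inner_delta.
set u := delta_mx 0 i; set v := delta_mx 0 j.
have [_ ver] := (hprojP pi x u _ gm).2 erefl.
rewrite -(subrK (hproj pi g x u) u) innerDl [RHS]innerDl (gh _ _ ver).
by congr (_ + _); rewrite inner_hproj // projE inner_hproj.
Qed.

End Submersions.

(** * The sheared metrics *)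

Section Shear.
Variables (R : realType) (m p : nat) (M : manifold R m) (N : manifold R p).
Variables (pi : M -> N) (g0 : M -> 'M[R]_m) (gN : N -> 'M[R]_p).
Variables (V : 'I_p -> M -> 'rV[R]_m) (W : 'I_p -> N -> 'rV[R]_p).
Hypothesis g0_metric : metric g0.
Hypothesis gN_metric : metric gN.
Hypothesis pi_subm : riemannian_submersion pi g0 gN.
Hypothesis V_vertical : forall i, vertical_field pi (V i).
Hypothesis W_field : forall i, vector_field (W i).
Implicit Types (x : M) (u v : 'rV[R]_m) (t : R) (c : chart M).

Let pi_smooth : smooth_map pi. Proof. by have [] := pi_subm. Qed.

(** Matrix, acting on rows, of the nilpotent endomorphism [S]; [mul_shear] gives its usual
    formula. *)
Definition shear x : 'M[R]_m :=
  differential pi x *m gN (pi x) *m (\matrix_i W i (pi x))^T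
    *m \matrix_i V i x.

Lemma mul_shear x u :
  u *m shear x =
  \sum_i inner gN (pi x) (u *m differential pi x) (W i (pi x)) *: V i x.
Proof.
rewrite /shear mulmxA mulmx_sum_row; apply: eq_bigr => i _; rewrite rowK.
congr (_ *: _); rewrite /inner !mulmxA !mxE; apply: eq_bigr => j _.
by rewrite !mxE.
Qed.

Lemma shear_differential x : shear x *m differential pi x = 0.
Proof.
rewrite /shear -mulmxA (_ : \matrix_i V i x *m _ = 0) ?mulmx0 //.
apply/row_matrixP => i; rewrite row_mul rowK row0.
by have [_] := V_vertical i; exact.
Qed.

Lemma vertical_shear x v : vertical pi x v -> v *m shear x = 0.
Proof. by rewrite /vertical /= /shear !mulmxA => ->; rewrite !mul0mx. Qed.

Lemma shear_sqr x : shear x *m shear x = 0.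
Proof. by rewrite {2}/shear !mulmxA shear_differential !mul0mx. Qed.

(** Gram matrix of the pullback of [g0] by [1 + t S]. *)
Definition sheared t x : 'M[R]_m :=
  (1%:M + t *: shear x) *m g0 x *m (1%:M + t *: shear x)^T.

Lemma inner_sheared t x u v :
  inner (sheared t) x u v =
  inner g0 x (u + t *: (u *m shear x)) (v + t *: (v *m shear x)).
Proof.
have E w : w + t *: (w *m shear x) = w *m (1%:M + t *: shear x).
  by rewrite mulmxDr mulmx1 -scalemxAr.
by rewrite /inner !E trmx_mul !mulmxA.
Qed.

Lemma inner_sheared_vertical t x v u : vertical pi x v ->
  inner (sheared t) x v u = inner g0 x v u + t * inner g0 x v (u *m shear x).
Proof.
move=> vv; rewrite inner_sheared (vertical_shear vv) scaler0 addr0.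
by rewrite innerDr innerZr.
Qed.

(** Applying [S] to the equation and using that its square is zero gives [u *m shear x = 0], hence
    [u = 0]. This injectivity makes the sheared forms positive definite. *)
Lemma shearK x t u :
  u + t *: (u *m shear x) = 0 -> u = 0.
Proof.
move=> E; have := congr1 (mulmxr (shear x)) E.
rewrite /= mul0mx mulmxDl -scalemxAl -mulmxA shear_sqr mulmx0 scaler0 addr0.
by move=> uS; move: E; rewrite uS scaler0 addr0.
Qed.

Definition local_shear c x : 'M[R]_m :=
  transition c (chart_at x) x *m shear x *m transition (chart_at x) c x.

Lemma gram_sheared t c x : dom c x ->
  gram (sheared t) c x =
  (1%:M + t *: local_shear c x) *m gram g0 c x
    *m (1%:M + t *: local_shear c x)^T.
Proof.
move=> cx; have ax := dom_chart_at x.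
move: (transition_inv ax cx); rewrite /gram /local_shear /sheared.
move: (transition c _ x) (transition _ c x) (shear x) => T T' S T'T.
have E : T *m (1%:M + t *: S) = (1%:M + t *: (T *m S *m T')) *m T.
  rewrite mulmxDr mulmxDl mulmx1 mul1mx -scalemxAr -scalemxAl.
  by rewrite -!mulmxA T'T mulmx1.
by rewrite !mulmxA E -[LHS]mulmxA -trmx_mul E trmx_mul !mulmxA.
Qed.

(** The transitions on [N] cancel, leaving only factors that are local expressions of smooth objects
    in fixed charts. *)
Lemma local_shearE c (d : chart N) x : dom c x -> dom d (pi x) ->
  local_shear c x =
  'J (local_map pi c d) (coord c x) *m gram gN d (pi x)
    *m (\matrix_i (W i (pi x) *m transition (chart_at (pi x)) d (pi x)))^T
    *m \matrix_i (V i x *m transition (chart_at x) c x).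
Proof.
move=> cx dx; have ax := dom_chart_at x; have ay := dom_chart_at (pi x).
have mulE (q r s : nat) (F : 'I_q -> 'rV[R]_r) (A : 'M[R]_(r, s)) :
    \matrix_i (F i *m A) = (\matrix_i F i) *m A.
  by apply/row_matrixP => i; rewrite row_mul !rowK.
rewrite !mulE (jacobian_local_map pi_smooth cx dx).
move: (transition_inv ay dx); rewrite /gram /local_shear /shear.
move: (transition c _ x) (transition _ c x) (transition _ d _)
  (transition d _ _) (differential pi x) (\matrix_i W i _) (\matrix_i V i x)
  => T T' Q Q' D Wx Vx QQ'.
rewrite trmx_mul !mulmxA -(mulmxA _ Q Q') QQ' mulmx1.
by rewrite -(mulmxA _ Q'^T Q^T) -trmx_mul QQ' trmx1 mulmx1.
Qed.

Lemma smooth_rows k (Q : manifold R k) (q : nat) (F : 'I_q -> Q -> 'rV[R]_k)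
    (d : chart Q) : (forall i, vector_field (F i)) ->
  smooth_on (coord d @` dom d) (fun z => \matrix_i
    (F i (uncoord d z) *m transition (chart_at (uncoord d z)) d (uncoord d z))).
Proof.
move=> FV; have o := @coord_open _ _ Q d.
apply/(smooth_mxP o) => i j; have /(smooth_mxP o)/(_ 0 j) := FV i d.
by apply: (smooth_ext o) => z _; rewrite [RHS]mxE.
Qed.

Lemma local_shear_smooth c :
  smooth_on (coord c @` dom c) (fun z => local_shear c (uncoord c z)).
Proof.
(* Smoothness is checked point by point, so a chart of [N] around [pi x] suffices; [local_shear]
   itself does not depend on [d]. *)
move=> s z [x cx <-]; set d := chart_at (pi x).
have dx : dom d (pi x) by exact: dom_chart_at.
have o := local_dom_open pi_smooth c d.
have J_smooth : smooth_on (local_dom pi c d) (fun z => 'J (local_map pi c d) z).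
  by apply: (smooth_jacobian o); exact: local_map_smooth.
have [_ _ gN_smooth] := gN_metric.
have GN := smooth_local_pullback pi_smooth c d (gN_smooth d).
have WN := smooth_local_pullback pi_smooth c d (smooth_rows (d:=d) W_field).
have VM := smooth_rows (d := c) (fun i => (V_vertical i).1).
have sub : local_dom pi c d `<=` coord c @` dom c.
  by move=> w [y [cy _] <-]; exists y.
have VM' := smooth_subset sub VM.
have h := smooth_mulmx o (smooth_mulmx o (smooth_mulmx o J_smooth GN)
  (smooth_trmx o WN)) VM'.
apply: (smooth_ext o _ h) => [w|]; last by exists x.
rewrite inE => -[y [cy dy] <-]; rewrite (coordK cy) (local_shearE cy dy).
by rewrite /local_map /= (coordK cy) (coordK dy).
Qed.

Lemma sheared_metric t : metric (sheared t).
Proof.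
have [gs gp g_smooth] := g0_metric.
split=> [x u v|x u u0|c].
- by rewrite !inner_sheared gs.
- by rewrite inner_sheared gp //; apply: contra_neq u0; exact: shearK.
have o := @coord_open _ _ M c.
have A_smooth : smooth_on (coord c @` dom c)
    (fun z => 1%:M + t *: local_shear c (uncoord c z)).
  apply: (smoothD o); first exact: (smooth_cst o).
  apply: (smooth_scalemx o); first exact: (smooth_cst o).
  exact: local_shear_smooth.
have := smooth_mulmx o (smooth_mulmx o A_smooth (g_smooth c))
  (smooth_trmx o A_smooth).
apply: (smooth_ext o) => z; rewrite inE => -[x cx <-].
by rewrite (coordK cx) gram_sheared.
Qed.

(** The map [1 + t S] fixes vertical vectors, so it sends horizontal vectors of the sheared metric
    to [g0]-horizontal ones; as [S] has vertical values, it preserves images under [pi]. *)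
Lemma sheared_submersion t : riemannian_submersion pi (sheared t) gN.
Proof.
have [_ rk gpi] := pi_subm; split => // x u v hu hv.
pose phi (w : 'rV[R]_m) := w + t *: (w *m shear x).
have phiD w : phi w *m differential pi x = w *m differential pi x.
  by rewrite mulmxDl -scalemxAl -mulmxA shear_differential mulmx0 scaler0 addr0.
have hphi w : horizontal pi (sheared t) x w -> horizontal pi g0 x (phi w).
  move=> hw v' vv'; have := hw _ vv'.
  by rewrite inner_sheared (vertical_shear vv') scaler0 addr0.
by rewrite inner_sheared -/(phi u) -/(phi v) gpi ?phiD //; exact: hphi.
Qed.

Lemma sheared_variation e : 0 < e -> metric_variation pi g0 e sheared.
Proof.
move=> e0; split=> [t _||c].
- split; first exact: sheared_metric.
  move=> X Y [_ vX] [_ vY] x.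
  rewrite inner_sheared (vertical_shear (vX x)) (vertical_shear (vY x)).
  by rewrite !scaler0 !addr0.
- by apply/funext => x; rewrite /sheared scale0r addr0 trmx1 mul1mx mulmx1.
set D := [set z | _].
have ct : continuous (fun z : 'rV[R]_(1 + m) => lsubmx z 0 0).
  move=> z; apply: (@continuous_comp _ _ _ lsubmx (fun A : 'M[R]_1 => A 0 0)).
    exact: continuous_lsubmx.
  exact: matrix_normedtype.coord_continuous.
have o : open D.
  apply: openI.
    apply: (@open_comp _ _ (fun z : 'rV[R]_(1 + m) => `|lsubmx z 0 0|)
        [set r | r < e]); last exact: open_lt.
    move=> z _; apply: continuous_comp; first exact: ct.
    exact: norm_continuous.
  apply: open_comp; last exact: coord_open.
  by move=> z _; exact: continuous_rsubmx.
have oc := @coord_open _ _ M c.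
(* Time and position are continuous linear functions of [z], so joint smoothness reduces to
   composition and matrix products. *)
have r_smooth : smooth_on D rsubmx.
  have := smooth_linear o (L := rsubmx) (@continuous_rsubmx R 1 1 m).
  by apply; exact: smooth_id o.
have t_smooth : smooth_on D (fun z => lsubmx z 0 0).
  have := smooth_linear o (L := lsubmx) (@continuous_lsubmx R 1 1 m).
  by move=> /(_ _ (smooth_id o))/(smooth_mxP o); exact.
have DU z : D z -> (coord c @` dom c) (rsubmx z) by case.
have S_smooth := smooth_comp_mx o oc DU (@local_shear_smooth c) r_smooth.
have [_ _ g_smooth] := g0_metric.
have G_smooth := smooth_comp_mx o oc DU (g_smooth c) r_smooth.
have A_smooth :=
  smoothD o (smooth_cst o 1%:M) (smooth_scalemx o t_smooth S_smooth).
have :=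
  smooth_mulmx o (smooth_mulmx o A_smooth G_smooth) (smooth_trmx o A_smooth).
apply: (smooth_ext o) => z; rewrite inE => -[_ [x cx <-]].
by rewrite (coordK cx) gram_sheared.
Qed.

Lemma dt_sheared t x :
  dt sheared t x = shear x *m g0 x + g0 x *m (shear x)^T
    + (t + t) *: (shear x *m g0 x *m (shear x)^T).
Proof.
rewrite /dt derive1E.
set A := shear x *m g0 x + g0 x *m (shear x)^T.
set B := shear x *m g0 x *m (shear x)^T.
have -> : (fun s => sheared s x) = (fun=> g0 x) + (fun s => s *: A)
    + (fun s => (s * s) *: B).
  apply/funext => s.
  rewrite /sheared linearD linearZ /= trmx1 !mulmxDr !mulmxDl.
  rewrite !mulmx1 !mul1mx -!scalemxAl -!scalemxAr scalerA.
  by rewrite -![(_ + _) s]/(_ + _) scalerDr !addrA.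
have d1 := is_derive_scalel A (is_derive_id t 1).
have d2 := is_derive_scalel B
  (is_deriveM (is_derive_id t 1) (is_derive_id t 1)).
have [_ ->] := is_deriveD (is_deriveD (is_derive_cst (g0 x) t 1) d1) d2.
by rewrite add0r scale1r -![_%:A]/(_ * 1) mulr1.
Qed.

(** Each projected lift pairs with [u] as [W i] pairs with the image of [u] in [N]. The value is the
    same for every submersion metric [g], so it serves both existence and uniqueness. *)
Lemma inner_prescribed (g : M -> 'M[R]_m) x v u : metric g ->
  riemannian_submersion pi g gN ->
  inner g x (\sum_(i < p) inner g0 x (V i x) v *:
    hproj pi g x (hlift pi g0 (W i) x)) u = inner g0 x v (u *m shear x).
Proof.
move=> gm gpi; have [gNs _ _] := gN_metric; have [g0s _ _] := g0_metric.
have [_ rk _] := pi_subm.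
rewrite inner_suml g0s mul_shear inner_suml; apply: eq_bigr => i _.
rewrite !innerZl (inner_hproj _ _ _ gm gpi) mulrC; congr (_ * _).
have [_ ->] := (hliftP (W i) _ g0_metric (rk x)).2 erefl.
exact: gNs.
Qed.

(** In [dt_sheared] the terms starting with [shear x] vanish on a vertical vector; the remaining
    one, [g0 x *m (shear x)^T], is the prescribed pairing. *)
Lemma sharp_sheared t X x : vertical_field pi X ->
  sharp (sheared t) (dt sheared t) X x =
  \sum_(i < p) inner g0 x (V i x) (X x) *:
    hproj pi (sheared t) x (hlift pi g0 (W i) x).
Proof.
move=> [_ vX]; apply/esym/(sharpP _ _ _ _ (sheared_metric t)) => u.
rewrite inner_prescribed; [|exact: sheared_metric|exact: sheared_submersion].
move: (vertical_shear (vX x)); rewrite /inner dt_sheared.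
move: (shear x) => S XS; rewrite !mulmxDr -scalemxAr !mulmxA XS.
by rewrite !mul0mx scaler0 addr0 add0r trmx_mul !mulmxA.
Qed.

End Shear.

(** Joint smoothness is restricted to the line of constant position through [x]. In the chart
    [chart_at x] the Gram matrix at [x] is [h s x] itself. *)
Lemma metric_variation_derivable (R : realType) (m p : nat) (M : manifold R m)
    (N : manifold R p) (pi : M -> N) (g0 : M -> 'M[R]_m) e
    (h : R -> M -> 'M[R]_m) t x :
  metric_variation pi g0 e h -> `|t| < e -> derivable (fun s => h s x) t 1.
Proof.
move=> [_ _ h_smooth] te; set c := chart_at x.
have cx : dom c x by exact: dom_chart_at.
pose l (s : R) : 'rV[R]_(1 + m) := row_mx 0 (coord c x) + s *: row_mx 1%:M 0.
have lE s : l s = row_mx s%:M (coord c x).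
  by rewrite /l scale_row_mx add_row_mx add0r scaler0 addr0 scalemx1.
have dl : differentiable l t.
  by apply: differentiableD => //; exact: differentiableZl.
have Dl : `|lsubmx (l t) 0 0| < e /\ (coord c @` dom c) (rsubmx (l t)).
  rewrite lE row_mxKl row_mxKr mxE eqxx mulr1n.
  by split => //; exists x.
have dh := smooth_differentiable (h_smooth c) Dl.
have hE : (fun z : 'rV[R]_(1 + m) =>
    gram (h (lsubmx z 0 0)) c (uncoord c (rsubmx z))) \o l = h^~ x.
  apply/funext => s.
  rewrite /= lE row_mxKl row_mxKr mxE eqxx mulr1n (coordK cx).
  by rewrite /gram (transition_refl cx) trmx1 mul1mx mulmx1.
by have := differentiable_comp dl dh; rewrite hE; exact: diff_derivable.
Qed.

(** * Existence by shearing, uniqueness by integration in time *)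

Theorem theorem3p6 (R : realType) (n p : nat)
    (M : manifold R (n + p)) (N : manifold R p) (pi : M -> N)
    (g0 : M -> 'M[R]_(n + p)) (gN : N -> 'M[R]_p)
    (V : 'I_p -> M -> 'rV[R]_(n + p)) (W : 'I_p -> N -> 'rV[R]_p) :
  metric g0 -> metric gN -> riemannian_submersion pi g0 gN ->
  (forall i, vertical_field pi (V i)) ->
  (forall i, bounded_field g0 (V i)) ->
  (forall i, vector_field (W i)) ->
  pointwise_independent W ->
  (forall i, bounded_field gN (W i)) ->
  exists2 eps : R, 0 < eps &
    let admissible (g : R -> M -> 'M[R]_(n + p)) :=
      [/\ metric_variation pi g0 eps g,
          preserves_submersion pi gN eps g
        & forall t, `|t| < eps ->
          forall X, vertical_field pi X -> forall x,
            sharp (g t) (dt g t) X x =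
            \sum_(i < p) inner g0 x (V i x) (X x) *:
              hproj pi (g t) x (hlift pi g0 (W i) x)] in
    exists2 g, admissible g &
      forall h, admissible h -> forall t, `|t| < eps -> h t = g t.
Proof.
move=> g0m gNm pi_subm V_vert _ W_field _ _.
(* The sheared metrics exist for all times, so any positive number can serve as [eps]. *)
exists 1 => //= ; exists (sheared pi g0 gN V W).
  split.
  - exact: sheared_variation.
  - by move=> t _; exact: sheared_submersion.
  - by move=> t _ X X_vert x; exact: sharp_sheared.
move=> h [h_var h_subm h_sharp] t t1; apply/funext => x.
have [h_riem h0 _] := h_var; have [pi_smooth rk _] := pi_subm.
have gm := sheared_metric g0m gNm pi_subm V_vert W_field t.
have gpi : riemannian_submersion pi (sheared pi g0 gN V W t) gN.
  exact: sheared_submersion.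
apply: (submersion_metric_eq (h_riem t t1).1 gm (h_subm t t1) gpi) => v u vv.
rewrite (inner_sheared_vertical _ _ _ _ _ _ vv).
(* Writing [g0] as [h 0] turns the goal into the affine formula for [f], whose derivative is shown
   to be constant. *)
rewrite -(f_equal (fun g => inner g x v u) h0).
pose f s := inner (h s) x v u.
apply: (@constant_derive_affine _ f 1 _ t _ t1) => s s1.
(* The prescribed equation speaks of vertical fields, so [v] is first extended to one. *)
have [X X_vert Xv] := vertical_extension pi_smooth (rk x) vv.
have dh := is_derive_inner v u (metric_variation_derivable (x := x) h_var s1).
apply: is_derive_eq dh _.
have hm := (h_riem s s1).1.
have /esym/(sharpP _ _ _ _ hm)/(_ u) := h_sharp s s1 X X_vert x.
rewrite Xv => <-.
apply: inner_prescribed;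
  [exact: g0m|exact: gNm|exact: pi_subm|exact: hm|exact: h_subm].
Qed.
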